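(* Let $\alpha\in(0,1)$, let $\Lambda\subset\mathbb{R}$ be a finite set of thresholds, and let $s$ be a step-level risk proxy; $\alpha$, $\Lambda$ and $s$ are fixed independently of the instances below (equivalently, everything is conditional on the data and choices used to construct them). Let $Z_i=(X_i,Y_i)$, $i=1,\dots,n+1$, be labeled reasoning instances such that $Z_1,\dots,Z_n,Z_{n+1}$ are exchangeable. Write $T_i$ for the number of steps of the trace in $X_i$, $Y_i=(Y_{i,1},\dots,Y_{i,T_i})\in\{0,1\}^{T_i}$, and $R_{i,t}=s_t(X_i)$ for $1\le t\le T_i$. Define $$\mathcal F=\Bigl\{\lambda\in\Lambda:\ \frac{1+\sum_{i=1}^n L_\lambda(Z_i)}{n+1}\le\alpha\Bigr\},$$ where $L_\lambda$ is the prefix-contamination loss. If $\mathcal F\neq\emptyset$, set $\widehat\lambda=\max\mathcal F$ and let $\widehat M=M_{\widehat\lambda}(R_{n+1,1},\dots,R_{n+1,T_{n+1}})$ be the retained prefix length of the future instance $X_{n+1}$; if $\mathcal F=\emptyset$, set $\widehat M=0$ (the empty prefix, which has zero contamination loss). Then $$\mathbb{P}\bigl\{\exists\, t\le \widehat M:\ Y_{n+1,t}=1\bigr\}\le\alpha,$$ where the probability is over all of $Z_1,\dots,Z_{n+1}$.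
   Context: A reasoning instance is a pair $X=(q,\tau)$ consisting of a question $q$ and a trace $\tau=(\tau_1,\dots,\tau_T)$ of steps; the length $T$ may vary with the instance. A labeled reasoning instance is $Z=(X,Y)$ with $Y=(Y_1,\dots,Y_T)\in\{0,1\}^T$, where $Y_t=1$ means that step $t$ is annotated as an error. Labeled instances are random elements; steps within one instance may be arbitrarily dependent, and exchangeability is only at the level of complete labeled instances. A step-level risk proxy is a fixed (measurable) function $s$ assigning to each instance $X$ with $T$ steps the real numbers $R_t=s_t(X)$, $t=1,\dots,T$ (depending on $X$ only, not on $Y$). No accuracy or calibration property of $s$ is assumed. For $\lambda\in\mathbb{R}$ the retained prefix length is $$M_\lambda(R_1,\dots,R_T)=\max\{m\in\{0,\dots,T\}:\ R_t\le\lambda\ \text{for every } 1\le t\le m\}.$$ The prefix-contamination loss of $Z=(X,Y)$ at threshold $\lambda$ is $$L_\lambda(Z)=\mathbf 1\{\exists\, t\in\{1,\dots,M_\lambda(R_1,\dots,R_T)\}:\ Y_t=1\},\qquad R_t=s_t(X).$$ *)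

(* Defs.v *)
From HB Require Import structures.
From mathcomp Require Import all_boot all_order all_algebra fingroup perm finmap.
From mathcomp Require Import all_classical all_reals all_analysis.

Set Implicit Arguments.
Unset Strict Implicit.
Unset Printing Implicit Defensive.

Import Order.TTheory GRing.Theory Num.Theory.

Local Open Scope classical_set_scope.
Local Open Scope ring_scope.

(* Finite sequences of arbitrary length carry the disjoint-union sigma-algebra
   of the spaces T^0, T^1, T^2, ...: a set of sequences is measurable iff its
   trace on each product space n.-tuple T is. *)
Definition measure_seq_display : measure_display -> measure_display.
Proof. exact. Qed.

Section measurable_seq.
Context {d} {T : measurableType d}.

Definition measurable_seq (A : set (seq T)) : Prop :=
  forall n, measurable ((fun u : n.-tuple T => tval u) @^-1` A).

Let measurable_seq0 : measurable_seq set0.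
Proof. by move=> n; rewrite preimage_set0. Qed.

Let measurable_seqC A : measurable_seq A -> measurable_seq (~` A).
Proof. by move=> mA n; rewrite preimage_setC; apply: measurableC; exact: mA. Qed.

Let measurable_seq_bigcup (F : (set (seq T))^nat) :
  (forall i, measurable_seq (F i)) -> measurable_seq (\bigcup_i F i).
Proof.
by move=> mF n; rewrite preimage_bigcup; apply: bigcup_measurable => k _; exact: mF.
Qed.

HB.instance Definition _ := isPointed.Build (seq T) [::].

HB.instance Definition _ := @isMeasurable.Build (measure_seq_display d) (seq T)
  measurable_seq measurable_seq0 measurable_seqC measurable_seq_bigcup.

End measurable_seq.

Definition reasoning_instance d1 d2 (Q : measurableType d1)
  (S : measurableType d2) := (Q * seq S)%type.

Definition trace d1 d2 (Q : measurableType d1) (S : measurableType d2)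
  (x : reasoning_instance Q S) : seq S := x.2.

Record labeled_instance d1 d2 (Q : measurableType d1) (S : measurableType d2) :=
  LabeledInstance {
    lval : reasoning_instance Q S * seq bool ;
    lvalP : size lval.2 == size (trace lval.1)
  }.

Definition inst d1 d2 (Q : measurableType d1) (S : measurableType d2)
  (z : labeled_instance Q S) : reasoning_instance Q S := (lval z).1.

Definition labels d1 d2 (Q : measurableType d1) (S : measurableType d2)
  (z : labeled_instance Q S) : seq bool := (lval z).2.

(* Labeled instances carry the sigma-algebra inherited from pairs (X, Y). *)
Section measurable_labeled_instance.
Context d1 d2 (Q : measurableType d1) (S : measurableType d2).

HB.instance Definition _ := [isSub for @lval d1 d2 Q S].
HB.instance Definition _ := [Choice of labeled_instance Q S by <:].
HB.instance Definition _ := isPointed.Build (labeled_instance Q S)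
  (@LabeledInstance _ _ Q S ((point, [::]), [::]) isT).

HB.instance Definition _ := Measurable.copy (labeled_instance Q S)
  (g_sigma_algebra_preimageType (@lval d1 d2 Q S)).

End measurable_labeled_instance.

(* Indices are shifted by one: step t (1 <= t <= T) is entry t - 1 of the
   sequences of risks and labels. Only entries below the sequence length are
   read, so the default values of nth play no role. *)
Definition retained (R : realType) (r : seq R) (lam : R) : nat :=
  \max_(m < (size r).+1 | [forall t : 'I_m, r`_t <= lam]) m.

Definition contaminated (y : seq bool) (m : nat) : bool :=
  [exists t : 'I_m, nth false y t].

Definition loss d1 d2 (Q : measurableType d1) (S : measurableType d2)
    (R : realType) (s : reasoning_instance Q S -> seq R) (lam : R)
    (z : labeled_instance Q S) : bool :=
  contaminated (labels z) (retained (s (inst z)) lam).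

Definition feasible d1 d2 (Q : measurableType d1) (S : measurableType d2)
    (R : realType) (s : reasoning_instance Q S -> seq R) (alpha : R)
    (Lambda : {fset R}) n (z : 'I_n -> labeled_instance Q S) : {fset R} :=
  [fset lam in Lambda |
    (1 + \sum_(i < n) loss s lam (z i))%N%:R / n.+1%:R <= alpha]%fset.

Definition fset_max (R : realType) (F : {fset R}) : option R :=
  if enum_fset F is x :: e then Some (\big[Num.max/x]_(y <- e) y) else None.

Lemma fset_max_None (R : realType) (F : {fset R}) :
  fset_max F = None <-> F = fset0%fset.
Proof.
rewrite /fset_max; split=> [|->]; last first.
  case E: (enum_fset fset0%fset) => [//|x e].
  by have := in_fset0 x; rewrite -[x \in fset0%fset]/(x \in enum_fset fset0%fset) E mem_head.
case E: (enum_fset F) => [|//] _; apply/fsetP => x.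
by rewrite in_fset0 -[x \in F]/(x \in enum_fset F) E.
Qed.

Lemma fset_max_Some (R : realType) (F : {fset R}) (x : R) :
  fset_max F = Some x <-> x \in F /\ {in F, forall y, y <= x}.
Proof.
have H a e : (forall y, (y \in F) = (y \in a :: e)) ->
    \big[Num.max/a]_(y <- e) y \in F /\
    {in F, forall y, y <= \big[Num.max/a]_(y <- e) y}.
  move=> FE; split; last first.
    move=> y; rewrite FE inE => /predU1P[->|ye].
      exact: bigmax_ge_id.
    exact: (@le_bigmax_seq _ _ _ _ _ _ xpredT idfun).
  rewrite FE; elim: e {FE} => [|b e IH]; first by rewrite big_nil inE.
  rewrite big_cons; case: leP => _; last by rewrite !inE eqxx orbT.
  by move: IH; rewrite !inE => /orP[->//|->]; rewrite !orbT.
rewrite /fset_max; case E: (enum_fset F) => [|a e].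
  split=> // -[xF _]; move: xF.
  by rewrite -[x \in F]/(x \in enum_fset F) E.
have [mF Fm] : _ /\ _ := H a e (fun y => congr1 (fun r => y \in r) E).
split=> [[<-]//|[xF Fx]]; congr Some.
by apply/eqP; rewrite eq_le Fx//= Fm.
Qed.

Definition selected_length d1 d2 (Q : measurableType d1)
    (S : measurableType d2) (R : realType)
    (s : reasoning_instance Q S -> seq R) (alpha : R) (Lambda : {fset R}) n
    (z : 'I_n -> labeled_instance Q S) (x : reasoning_instance Q S) : nat :=
  if fset_max (feasible s alpha Lambda z) is Some lam
  then retained (s x) lam else 0%N.

Definition risk_proxy d1 d2 (Q : measurableType d1) (S : measurableType d2)
    (R : realType) (s : reasoning_instance Q S -> seq R) : Prop :=
  measurable_fun [set: reasoning_instance Q S] s /\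
  forall x, size (s x) = size (trace x).

Definition exchangeable d d' (Omega : measurableType d) (E : measurableType d')
    (R : realType) (P : probability Omega R) m (Z : 'I_m -> Omega -> E) : Prop :=
  forall (sigma : {perm 'I_m}) (B : set (m.-tuple E)), measurable B ->
    P ((fun w => [tuple Z (sigma i) w | i < m]) @^-1` B) =
    P ((fun w => [tuple Z i w | i < m]) @^-1` B).

(* Main.v *)
(* Loss is monotone in the threshold.  Replacing the 1 in the calibration
   condition by the unknown loss of the future instance only enlarges the
   feasible set, and makes it a symmetric function of all n+1 instances.  The
   event that some threshold feasible for this symmetric condition contaminates
   instance j therefore has the same probability for every j, while pointwise
   at most alpha (n+1) of these n+1 events hold, namely those of the instances
   contaminated at the largest such threshold. *)
Require Import Defs.
From mathcomp Require Import all_boot all_order all_algebra finmap.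
From mathcomp Require Import fingroup perm.
From mathcomp Require Import all_classical all_reals all_analysis.
From mathcomp Require Import measurable_realfun.

Set Implicit Arguments.
Unset Strict Implicit.
Unset Printing Implicit Defensive.

Import Order.TTheory GRing.Theory Num.Theory.

Local Open Scope classical_set_scope.
Local Open Scope ring_scope.

(** * Monotonicity in the threshold *)

Lemma ltn_retained (R : realType) (r : seq R) (lam : R) (t : nat) :
  (t < retained r lam)%N =
  (t < size r)%N && [forall i : 'I_t.+1, r`_i <= lam].
Proof.
apply/idP/andP => [|[tr /forallP h]].
  rewrite /retained => h.
  have [m /forallP mP mE] : {m : 'I_(size r).+1 |
      [forall i : 'I_m, r`_i <= lam] &
      \max_(m < (size r).+1 | [forall t : 'I_m, r`_t <= lam]) m = m :> nat}.
    apply: eq_bigmax_cond; apply/card_gt0P; exists ord0.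
    by apply/forallP => -[].
  rewrite mE in h; split.
    by apply: leq_trans h _; rewrite -ltnS.
  apply/forallP => i; have im : (i < m)%N := leq_trans (ltn_ord i) h.
  exact: mP (Ordinal im).
have tr1 : (t.+1 < (size r).+1)%N by [].
apply: (@leq_bigmax_cond _ (fun m : 'I_(size r).+1 =>
  [forall i : 'I_m, r`_i <= lam]) (fun m => m : nat) (Ordinal tr1)).
exact/forallP.
Qed.

Lemma retained_le (R : realType) (r : seq R) (lam mu : R) :
  lam <= mu -> (retained r lam <= retained r mu)%N.
Proof.
move=> lm; case E: (retained r lam) => [//|t].
have : (t < retained r lam)%N by rewrite E.
rewrite !ltn_retained => /andP[-> /forallP h]; apply/forallP => i.
exact: le_trans (h i) lm.
Qed.

Lemma contaminatedP (y : seq bool) (m : nat) :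
  reflect (exists2 t, (t < m)%N & nth false y t) (contaminated y m).
Proof.
apply: (iffP existsP) => [[t yt]|[t tm yt]]; first by exists t.
by exists (Ordinal tm).
Qed.

Lemma contaminated_le (y : seq bool) (m p : nat) :
  (m <= p)%N -> contaminated y m -> contaminated y p.
Proof.
move=> mp /contaminatedP[t tm yt]; apply/contaminatedP; exists t => //.
exact: leq_trans tm mp.
Qed.

(** A larger threshold retains a longer prefix, which still contains any error already retained. *)
Lemma loss_le d1 d2 (Q : measurableType d1) (S : measurableType d2)
    (R : realType) (s : reasoning_instance Q S -> seq R) (lam mu : R)
    (z : labeled_instance Q S) :
  lam <= mu -> loss s lam z -> loss s mu z.
Proof. by move=> lm; apply: contaminated_le; exact: retained_le. Qed.

(** * Measurability of the events *)

(** On [k]-tuples the set is the preimage of [A] under a projection if [t < k], and empty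
    otherwise. *)
Lemma measurable_seq_nth d (T : measurableType d) (x0 : T) (t : nat)
    (A : set T) : measurable A ->
  measurable [set u : seq T | (t < size u)%N /\ A (nth x0 u t)].
Proof.
move=> mA; rewrite -[measurable _]/(measurable_seq _) => k.
case: (ltnP t k) => tk.
  rewrite (_ : _ @^-1` _ = (fun u : k.-tuple T => tnth u (Ordinal tk)) @^-1` A).
    by rewrite -[X in measurable X]setTI; apply: measurable_tnth.
  apply/seteqP; split=> u /=; rewrite size_tuple (tnth_nth x0).
    by case.
  by [].
rewrite (_ : _ @^-1` _ = set0) //.
apply/seteqP; split=> u //= -[]; rewrite size_tuple => h.
by move: (leq_ltn_trans tk h); rewrite ltnn.
Qed.

Lemma measurable_lt_retained (R : realType) (lam : R) (t : nat) :
  measurable [set r : seq R | (t < retained r lam)%N].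
Proof.
rewrite (_ : [set _ | _] = \bigcap_(i in `I_t.+1)
   [set r : seq R | (i < size r)%N /\ r`_i \in `]-oo, lam]]).
  apply: bigcap_measurable => // [|i _]; first by exists 0%N.
  exact: (@measurable_seq_nth _ R 0 i `]-oo, lam]%classic).
apply/seteqP; split=> r /=; rewrite ltn_retained.
  move=> /andP[tr /forallP h] i /= it; split; first exact: leq_trans it tr.
  by rewrite in_itv /=; exact: h (Ordinal it).
move=> h; apply/andP; split; first by case: (h t (ltnSn t)).
apply/forallP => i; have [_] := h i (ltn_ord i).
by rewrite in_itv.
Qed.

Lemma measurable_loss d1 d2 (Q : measurableType d1) (S : measurableType d2)
    (R : realType) (s : reasoning_instance Q S -> seq R) (lam : R) :
  measurable_fun [set: reasoning_instance Q S] s ->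
  measurable [set z : labeled_instance Q S | loss s lam z].
Proof.
move=> ms.
(* Measurability on labeled instances asks for a measurable set of pairs (X, Y) whose preimage under
   [lval] is the event; this one is a countable union of rectangles, one per possible error
   position. *)
pose A := \bigcup_t ([set x : reasoning_instance Q S |
                       (t < retained (s x) lam)%N] `*`
                     [set y : seq bool | (t < size y)%N /\ nth false y t]).
exists A.
  apply: bigcup_measurable => t _; apply: measurableX.
    rewrite -[X in measurable X]setTI.
    exact: ms measurableT _ (measurable_lt_retained lam t).
  exact: (@measurable_seq_nth _ bool false t [set b | b]).
rewrite setTI; apply/seteqP; split=> z /=.
  by move=> [t _ [/= ht [_ yt]]]; apply/contaminatedP; exists t.
move=> /contaminatedP[t ht yt]; exists t => //; split=> //=; split=> //.
(* The default label is [false], so an error at [t] forces [t < size y]. *)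
by rewrite ltnNge; apply/negP => h; move: yt; rewrite nth_default.
Qed.

(** The count depends only on which of the events hold; there are finitely many such patterns [f],
    each cut out by a finite intersection of events and complements. *)
Lemma measurable_count d (T : measurableType d) (I : finType)
    (b : I -> T -> bool) (p : pred nat) :
  (forall i, measurable [set t | b i t]) ->
  measurable [set t | p (\sum_i b i t)%N].
Proof.
move=> mb.
rewrite (_ : [set _ | _] = \bigcup_(f in [set f : {ffun I -> bool} |
    p (\sum_i f i)%N]) \bigcap_(i in [set: I]) [set t | b i t = f i]).
  apply: fin_bigcup_measurable => // f _; apply: fin_bigcap_measurable => // i _.
  case: (f i); first exact: mb.
  rewrite (_ : [set _ | _] = ~` [set t | b i t]); first exact: measurableC.
  by apply/seteqP; split=> t /=; [move->|move/negP/negbTE].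
apply/seteqP; split=> t /=.
  move=> pt; exists [ffun i => b i t] => /=; last by move=> i _; rewrite /= ffunE.
  by under eq_bigr do rewrite ffunE.
move=> [f /= pf bf]; by under eq_bigr => i _ do rewrite (bf i Logic.I).
Qed.

(** Common shape of the events below, on [Omega] and on tuples alike; [p] stands for either
    calibration condition. *)
Lemma measurable_exists_count d (T : measurableType d) (R : realType)
    (Lambda : {fset R}) (I : finType) (b : R -> I -> T -> bool)
    (c : R -> T -> bool) (p : pred nat) :
  (forall lam i, measurable [set t | b lam i t]) ->
  (forall lam, measurable [set t | c lam t]) ->
  measurable [set t | exists2 lam, lam \in Lambda &
    p (\sum_i b lam i t)%N /\ c lam t].
Proof.
move=> mb mc.
rewrite (_ : [set _ | _] = \bigcup_(lam in [set` Lambda])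
    ([set t | p (\sum_i b lam i t)%N] `&` [set t | c lam t])).
  apply: fin_bigcup_measurable => // lam _; apply: measurableI => //.
  exact: measurable_count.
by apply/seteqP; split=> t /= -[lam lamL [h1 h2]]; exists lam.
Qed.

Lemma measurable_mfun_preimage d d' (T : measurableType d)
    (U : measurableType d') (f : {mfun T >-> U}) (A : set U) :
  measurable A -> measurable (f @^-1` A).
Proof. by move=> mA; rewrite -[X in measurable X]setTI; exact: measurable_funP. Qed.

(* By monotonicity of the loss, the selected maximum can be traded for an
   existential over the finite set of thresholds, which is clearly measurable. *)
Lemma selected_length_contaminated d1 d2 (Q : measurableType d1)
    (S : measurableType d2) (R : realType)
    (s : reasoning_instance Q S -> seq R) (alpha : R) (Lambda : {fset R})
    (n : nat) (z : 'I_n -> labeled_instance Q S) (z' : labeled_instance Q S) :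
  contaminated (labels z') (selected_length s alpha Lambda z (inst z')) <->
  exists2 lam, lam \in Lambda &
    (1 + \sum_(i < n) loss s lam (z i))%N%:R / n.+1%:R <= alpha /\
    loss s lam z'.
Proof.
rewrite /selected_length; case E: fset_max => [lam|].
  move/fset_max_Some: E => [lamF lam_max]; split.
    move: lamF; rewrite !inE => /andP[lamL lama] h.
    by exists lam.
  move=> [mu muL [mua lmu]]; apply: loss_le lmu; apply: lam_max.
  by rewrite !inE; apply/andP.
move/fset_max_None: E => F0; split.
  by move=> /contaminatedP[].
move=> [mu muL [mua _]].
have : mu \in feasible s alpha Lambda z by rewrite !inE; apply/andP.
by rewrite F0 in_fset0.
Qed.

(** * Counting and exchangeability *)

Lemma sum_contaminable_le d1 d2 (Q : measurableType d1)
    (S : measurableType d2) (R : realType)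
    (s : reasoning_instance Q S -> seq R) (c : R) (Lambda : {fset R})
    (m : nat) (z : 'I_m -> labeled_instance Q S) : 0 <= c ->
  \sum_(j < m) (`[< exists2 lam, lam \in Lambda &
    (\sum_(i < m) loss s lam (z i))%N%:R <= c /\ loss s lam (z j) >])%:R <= c.
Proof.
move=> c0.
pose F := [fset lam in Lambda | (\sum_(i < m) loss s lam (z i))%N%:R <= c]%fset.
case E: (fset_max F) => [lam|].
  move/fset_max_Some: E => [lamF lam_max].
  (* It suffices to bound the count by the total loss at the maximum [lam], term by term: an
     instance contaminated at a feasible [mu <= lam] is contaminated at [lam]. *)
  move: lamF; rewrite !inE => /andP[lamL]; apply: le_trans.
  rewrite natr_sum; apply: ler_sum => j _; rewrite ler_nat.
  case: asboolP => // -[mu muL [mua lmu]].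
  suff -> : loss s lam (z j) by [].
  by apply: loss_le lmu; apply: lam_max; rewrite !inE; apply/andP.
move/fset_max_None: E => F0.
rewrite big1 // => j _; case: asboolP => // -[mu muL [mua _]].
have : mu \in F by rewrite !inE; apply/andP.
by rewrite F0 in_fset0.
Qed.

(** The sum is the expected number of events that occur, and this number is at most [c]
    everywhere. *)
Lemma sum_probability_le d (T : measurableType d) (R : realType)
    (P : probability T R) (m : nat) (A : 'I_m -> set T) (c : R) :
  (forall j, measurable (A j)) ->
  (forall w, \sum_(j < m) \1_(A j) w <= c) ->
  (\sum_(j < m) P (A j) <= c%:E)%E.
Proof.
move=> mA Ac.
have -> : (\sum_(j < m) P (A j) =
    \int[P]_w \sum_(j < m) (\1_(A j) w)%:E)%E.
  rewrite ge0_integral_sum//; last first.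
    by move=> j; apply/measurable_EFinP; exact: measurable_indic.
  by apply: eq_bigr => j _; rewrite integral_indic// setIT.
have -> : (c%:E = \int[P]_w (cst c%:E w))%E.
  by rewrite integral_cst//= probability_setT mule1.
apply: ge0_le_integral => //.
- by move=> w _; apply: sume_ge0 => j _; rewrite lee_fin.
- apply: emeasurable_sum => j.
  by apply/measurable_EFinP; exact: measurable_indic.
- by move=> w _; rewrite /= sumEFin lee_fin.
Qed.

(** Transfers exchangeability from sets of tuples to predicates on indexed families. *)
Lemma exchangeable_permuted_event d d' (T : measurableType d)
    (E : measurableType d') (R : realType) (P : probability T R) (m : nat)
    (Z : 'I_m -> T -> E) (G : ('I_m -> E) -> Prop) (sigma : {perm 'I_m}) :
  exchangeable P Z -> measurable [set u : m.-tuple E | G (tnth u)] ->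
  P [set w | G (fun i => Z (sigma i) w)] = P [set w | G (fun i => Z i w)].
Proof.
move=> exZ mG.
have tnthE (f : 'I_m -> E) : tnth [tuple f i | i < m] = f.
  by apply/funext => i; rewrite tnth_mktuple.
have := exZ sigma _ mG.
rewrite /preimage /=.
under eq_set do rewrite tnthE.
by under [in X in _ = X -> _]eq_set do rewrite tnthE.
Qed.

Theorem proposition1 (R : realType) (dQ dS dO : measure_display)
    (Q : measurableType dQ) (S : measurableType dS)
    (Omega : measurableType dO) (P : probability Omega R)
    (alpha : R) (Lambda : {fset R})
    (s : reasoning_instance Q S -> seq R) (n : nat)
    (Z : 'I_n.+1 -> {mfun Omega >-> labeled_instance Q S}) :
  0 < alpha < 1 ->
  risk_proxy s ->
  exchangeable P (fun i w => Z i w) ->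
  (P [set w |
     let Mhat := selected_length s alpha Lambda
                   (fun i : 'I_n => Z (widen_ord (leqnSn n) i) w)
                   (inst (Z ord_max w)) in
     contaminated (labels (Z ord_max w)) Mhat] <= alpha%:E)%E.
Proof.
move=> /andP[alpha0 _] [ms _] exZ.
(* The calibration bound with the denominator cleared. *)
pose c := alpha * n.+1%:R.
have c0 : 0 <= c by rewrite mulr_ge0// ltW.
have mL lam : measurable [set z | loss s lam z] := measurable_loss lam ms.
pose G j (z : 'I_n.+1 -> labeled_instance Q S) := exists2 lam, lam \in Lambda &
  (\sum_(i < n.+1) loss s lam (z i))%N%:R <= c /\ loss s lam (z j).
pose A j := [set w | G j (fun i => Z i w)].
have mZ lam i : measurable [set w | loss s lam (Z i w)].
  exact: measurable_mfun_preimage (mL lam).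
have mA j : measurable (A j).
  exact: (@measurable_exists_count _ Omega R Lambda 'I_n.+1
    (fun lam i w => loss s lam (Z i w)) (fun lam w => loss s lam (Z j w))
    (fun k => k%:R <= c)).
have PA j : P (A j) = P (A ord_max).
  have mT lam i : measurable [set u : n.+1.-tuple (labeled_instance Q S) |
      loss s lam (tnth u i)].
    rewrite -[X in measurable X]setTI; exact: measurable_tnth (mL lam).
  (* Swapping [j] with the last index leaves the total loss unchanged and puts instance [j] in the
     future position. *)
  rewrite -(exchangeable_permuted_event (G := G ord_max) (tperm j ord_max) exZ).
    congr (P _); apply/seteqP; split=> w /= -[lam lamL [h1 h2]];
      exists lam => //; split=> //.
    - move: h1; congr (_%:R <= _).
      exact: (reindex_perm (tperm j ord_max)).
    - by rewrite tpermR.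
    - move: h1; congr (_%:R <= _).
      exact/esym/(reindex_perm (tperm j ord_max)).
    - by move: h2; rewrite tpermR.
  exact: (@measurable_exists_count _ _ R Lambda 'I_n.+1
    (fun lam i u => loss s lam (tnth u i))
    (fun lam u => loss s lam (tnth u ord_max)) (fun k => k%:R <= c)).
have PAc : (P (A ord_max) <= alpha%:E)%E.
  have : (\sum_(j < n.+1) P (A j) <= c%:E)%E.
    apply: sum_probability_le => // w.
    apply: le_trans (sum_contaminable_le s Lambda (fun i => Z i w) c0).
    by apply: ler_sum => j _; rewrite indicE (lexx (`[< A j w >]%:R : R)).
  (* All summands equal [P (A ord_max)]; passing to real numbers allows the factor [n.+1] to be
     cancelled. *)
  rewrite -(fineK (fin_num_measure P _ (mA ord_max))).
  under eq_bigr => j _ do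
    rewrite PA -(fineK (fin_num_measure P _ (mA ord_max))).
  by rewrite sumEFin !lee_fin sumr_const card_ord -mulr_natr ler_pM2r.
apply: le_trans PAc; rewrite /=.
under eq_set do rewrite (propext (selected_length_contaminated _ _ _ _ _)).
apply: le_measure; rewrite ?inE//.
  exact: (@measurable_exists_count _ Omega R Lambda 'I_n
    (fun lam i w => loss s lam (Z (widen_ord (leqnSn n) i) w))
    (fun lam w => loss s lam (Z ord_max w))
    (fun k => (1 + k)%N%:R / n.+1%:R <= alpha)).
move=> w /= [lam lamL [h1 h2]]; exists lam => //; split=> //.
(* Here the future instance has loss 1 at [lam] by [h2], so the added 1 is exactly the last term of
   the full sum. *)
by move: h1; rewrite ler_pdivrMr// big_ord_recr /= h2 addnC.
Qed.
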